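(* Let $f:\mathbb{R}^n\to\overline{\mathbb{R}}=\mathbb{R}\cup\{\pm\infty\}$ be a function, $\bar{x}\in\mathbb{R}^n$ a point where $f$ is finite and locally lower semicontinuous, and $\bar{v}\in\mathbb{R}^n$ a vector. The level-set mapping $S:\mathbb{R}\rightrightarrows\mathbb{R}^n$, $$S:\alpha\mapsto\{x\mid f(x)-\langle\bar{v},x-\bar{x}\rangle\le\alpha\},$$ has the Lipschitz-like property relative to $$X:=\{\alpha\in\mathbb{R}\mid\alpha\ge f(\bar{x})\}$$ at $f(\bar{x})$ for $\bar{x}$ if and only if $$\bar{v}\notin\partial^>_{\bar{v}}f(\bar{x}).$$ Moreover, $$\operatorname{lip}_XS(f(\bar{x})\mid\bar{x})=\frac{1}{d(\bar{v},\partial^>_{\bar{v}}f(\bar{x}))}.$$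
   Context: $f$ is locally lower semicontinuous at $\bar{x}$ (where it is finite) if there is $\epsilon>0$ such that all sets $\{x\mid\|x-\bar{x}\|\le\epsilon,\ f(x)\le\alpha\}$ with $\alpha\le f(\bar{x})+\epsilon$ are closed. Subgradients: at a point $x$ with $f(x)$ finite, $v\in\widehat{\partial}f(x)$ if $f(y)\ge f(x)+\langle v,y-x\rangle+o(\|y-x\|)$; $v\in\partial f(x)$ if there are $x_k\to x$ with $f(x_k)\to f(x)$ and $v_k\in\widehat{\partial}f(x_k)$ with $v_k\to v$; $\partial f(x)=\emptyset$ where $f$ is not finite. Outer limiting subdifferential set of $f$ at $\bar{x}$ with respect to $\bar{v}$ (its elements are also called structural subgradients): $\partial^>_{\bar{v}}f(\bar{x})$ is the set of all limits $\lim_kv_k$, where there is a sequence $x_k\to\bar{x}$ with $f(x_k)\to f(\bar{x})$ such that for all $k$, $f(x_k)>f(\bar{x})+\langle\bar{v},x_k-\bar{x}\rangle$ and $v_k\in\partial f(x_k)$. Lipschitz-like property of $S:\mathbb{R}^p\rightrightarrows\mathbb{R}^q$ relative to $X\subset\mathbb{R}^p$ at $\bar{\alpha}\in X$ for $\bar{u}\in S(\bar{\alpha})$: $\operatorname{gph}S=\{(\alpha,u)\mid u\in S(\alpha)\}$ is locally closed at $(\bar{\alpha},\bar{u})$ (i.e. its intersection with some closed neighborhood of that point is closed) and there are neighborhoods $V$ of $\bar{\alpha}$, $W$ of $\bar{u}$ and $\kappa\ge0$ such that $S(\alpha')\cap W\subset S(\alpha)+\kappa\|\alpha'-\alpha\|\mathbb{B}$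 for all $\alpha,\alpha'\in X\cap V$, where $\mathbb{B}$ is the closed unit ball. The graphical modulus $\operatorname{lip}_XS(\bar{\alpha}\mid\bar{u})$ is the infimum of all $\kappa\ge0$ for which such $V,W$ exist making this inclusion hold ($\inf\emptyset=+\infty$). $d(x,A)=\inf_{y\in A}\|y-x\|$ with $d(x,\emptyset)=+\infty$. Conventions: $1/0=+\infty$ and $1/(+\infty)=0$. *)

(* Defs.v *)
From HB Require Import structures.
From mathcomp Require Import all_boot all_order all_algebra.
From mathcomp Require Import all_classical all_reals all_analysis.

Set Implicit Arguments.
Unset Strict Implicit.
Unset Printing Implicit Defensive.

Import Order.TTheory GRing.Theory Num.Theory.
Import numFieldNormedType.Exports.

Local Open Scope classical_set_scope.
Local Open Scope ring_scope.

(* Euclidean space R^n is 'rV[R]_n.  The library norm `|x| on 'rV[R]_n is the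
   sup norm, so the Euclidean norm is defined here and used in every
   quantitative notion.  Both norms induce the library topology of 'rV[R]_n,
   which is the one used for neighbourhoods, limits and closedness. *)
Definition dotv (R : realType) (n : nat) (u v : 'rV[R]_n) : R :=
  \sum_(i < n) u 0 i * v 0 i.

Definition enorm (R : realType) (n : nat) (u : 'rV[R]_n) : R :=
  Num.sqrt (dotv u u).

Definition eball (R : realType) (n : nat) : set 'rV[R]_n :=
  [set b | enorm b <= 1].

(* [ereal_inf set0 = +oo]. *)
Definition dist_to_set (R : realType) (n : nat) (x : 'rV[R]_n) (A : set 'rV[R]_n) :
    \bar R :=
  ereal_inf [set (enorm (y - x))%:E | y in A].

Definition locally_lsc_at (R : realType) (n : nat) (f : 'rV[R]_n -> \bar R)
    (xb : 'rV[R]_n) : Prop :=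
  exists2 e : R, 0 < e &
    forall a : R, (a%:E <= f xb + e%:E)%E ->
      closed [set x | enorm (x - xb) <= e /\ (f x <= a%:E)%E].

(* The term o(||y - x||) is unfolded: for every e > 0 the inequality holds up to
   e * ||y - x|| for all y close to x. *)
Definition regular_subdiff (R : realType) (n : nat) (f : 'rV[R]_n -> \bar R)
    (x : 'rV[R]_n) : set 'rV[R]_n :=
  [set v | f x \is a fin_num /\
    forall e : R, 0 < e ->
      \forall y \near x,
        (f x + (dotv v (y - x) - e * enorm (y - x))%:E <= f y)%E].

Definition limiting_subdiff (R : realType) (n : nat) (f : 'rV[R]_n -> \bar R)
    (x : 'rV[R]_n) : set 'rV[R]_n :=
  [set v | f x \is a fin_num /\
    exists (x_ v_ : nat -> 'rV[R]_n),
      [/\ x_ k @[k --> \oo] --> x,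
          f (x_ k) @[k --> \oo] --> f x,
          forall k, regular_subdiff f (x_ k) (v_ k) &
          v_ k @[k --> \oo] --> v]].

Definition outer_limiting_subdiff (R : realType) (n : nat)
    (f : 'rV[R]_n -> \bar R) (vb xb : 'rV[R]_n) : set 'rV[R]_n :=
  [set v | exists (x_ v_ : nat -> 'rV[R]_n),
    [/\ x_ k @[k --> \oo] --> xb,
        f (x_ k) @[k --> \oo] --> f xb,
        forall k, (f xb + (dotv vb (x_ k - xb))%:E < f (x_ k))%E,
        forall k, limiting_subdiff f (x_ k) (v_ k) &
        v_ k @[k --> \oo] --> v]].

(* Set-valued mappings R => R^n are functions R -> set 'rV[R]_n; only a
   one-dimensional parameter is needed, with norm the absolute value. *)
Definition gph (R : realType) (n : nat) (S : R -> set 'rV[R]_n) :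
    set (R * 'rV[R]_n) :=
  [set p | S p.1 p.2].

Definition locally_closed_at (T : topologicalType) (A : set T) (p : T) : Prop :=
  exists N : set T, [/\ nbhs p N, closed N & closed (A `&` N)].

Definition lipschitz_inclusion (R : realType) (n : nat)
    (S : R -> set 'rV[R]_n) (X : set R) (ab : R) (ub : 'rV[R]_n) (k : R) :
    Prop :=
  exists (V : set R) (W : set 'rV[R]_n),
    [/\ nbhs ab V, nbhs ub W &
      forall a a' : R, (X `&` V) a -> (X `&` V) a' ->
        S a' `&` W `<=`
        [set u + (k * `|a' - a|) *: b | u in S a & b in @eball R n]].

Definition lipschitz_like (R : realType) (n : nat) (S : R -> set 'rV[R]_n)
    (X : set R) (ab : R) (ub : 'rV[R]_n) : Prop :=
  [/\ X ab, S ab ub, locally_closed_at (gph S) (ab, ub) &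
      exists2 k : R, 0 <= k & lipschitz_inclusion S X ab ub k].

Definition graphical_modulus (R : realType) (n : nat) (S : R -> set 'rV[R]_n)
    (X : set R) (ab : R) (ub : 'rV[R]_n) : \bar R :=
  ereal_inf [set k%:E | k in [set k : R | 0 <= k /\
                                lipschitz_inclusion S X ab ub k]].

Definition level_set (R : realType) (n : nat) (f : 'rV[R]_n -> \bar R)
    (vb xb : 'rV[R]_n) (a : R) : set 'rV[R]_n :=
  [set x | (f x - (dotv vb (x - xb))%:E <= a%:E)%E].

(* Main.v *)
Require Import Defs.
From HB Require Import structures.
From mathcomp Require Import all_boot all_order all_algebra.
From mathcomp Require Import all_classical all_reals all_analysis.
From mathcomp Require Import ring lra.

Set Implicit Arguments.
Unset Strict Implicit.
Unset Printing Implicit Defensive.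

Import Order.TTheory GRing.Theory Num.Theory.
Import numFieldNormedType.Exports.

Local Open Scope classical_set_scope.
Local Open Scope ring_scope.

(** Subtracting the linear function [<vb, x - xb>] from [f] gives a function
[g] (the tilt of [f]) with [g xb = f xb =: c], whose sublevel sets are the
values of [S], and whose subgradients are those of [f] shifted by [- vb].  The
distance of [vb] to the outer limiting subdifferential is thus the smallest
limiting norm of regular subgradients of [g] at points [x] near [xb] with
[c < g x] and [g x] close to [c] ([outer_limiting_subdiffP],
[outer_limiting_subdiff_bounded]).  The theorem says that the reciprocal of
this smallest slope is the best Lipschitz constant of the sublevel sets.

If the sublevel sets grow with rate at most [k], then from [x] with
[g x = t > c] the level [a < t] is reached by a step of length at most
[k (t - a)].  Letting [a] tend to [t], a regular subgradient [w] at [x] must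
allow a decrease at rate [1/k], so [1 <= k |w|] ([inclusion_slope_ge]).

Conversely, let the inclusion with constant [k] fail: some [x'] close to [xb]
has [g x' <= a'], but no point of the level [a < a'] within
[k (a' - a)] of it.  For [l < k] the function
[max (g, a) + |. - x'| / l] attains its minimum on the ball of radius
[k (a' - a)] at a point which is too close to [x'] to be in the level set of
[a]; there [max (g, a)] coincides with [g], so that the negative gradient of
the penalty, of norm at most [1/l], is a regular subgradient of [g].  Replacing
the norm by the smooth [sqrt (|.|^2 + m^2)], which is affordable because
[l < k], makes a sum rule unnecessary, and compactness of balls replaces a
variational principle ([not_inclusion_slope_le]).

The two estimates, together with the compactness of the ball of radius [1/l]
in the space of subgradients, determine the graphical modulus ([modulus_eq]).
The outer limiting subdifferential is closed, so the constant is finite exactly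
when [vb] does not belong to it; and the graph of [S] is always locally closed,
by lower semicontinuity ([level_set_locally_closed]). *)

(** * Euclidean inner product and norm *)

Section Euclid.
Context {R : realType} {n : nat}.
Implicit Types (u v w x y : 'rV[R]_n).

Lemma dotvC u v : dotv u v = dotv v u.
Proof. by apply: eq_bigr => i _; rewrite mulrC. Qed.

Lemma dotvDr u v w : dotv u (v + w) = dotv u v + dotv u w.
Proof. by rewrite -big_split /=; apply: eq_bigr => i _; rewrite mxE mulrDr. Qed.

Lemma dotvZr (c : R) u v : dotv u (c *: v) = c * dotv u v.
Proof. by rewrite mulr_sumr; apply: eq_bigr => i _; rewrite mxE mulrCA. Qed.

Lemma dotvNr u v : dotv u (- v) = - dotv u v.
Proof. by rewrite -scaleN1r dotvZr mulN1r. Qed.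

Lemma dotvBr u v w : dotv u (v - w) = dotv u v - dotv u w.
Proof. by rewrite dotvDr dotvNr. Qed.

Lemma dotv0r u : dotv u 0 = 0.
Proof. by rewrite -(scale0r 0) dotvZr mul0r. Qed.

Lemma dotvDl u v w : dotv (u + v) w = dotv u w + dotv v w.
Proof. by rewrite dotvC dotvDr !(dotvC w). Qed.

Lemma dotvZl (c : R) u v : dotv (c *: u) v = c * dotv u v.
Proof. by rewrite dotvC dotvZr dotvC. Qed.

Lemma dotvNl u v : dotv (- u) v = - dotv u v.
Proof. by rewrite dotvC dotvNr dotvC. Qed.

Lemma dotvv_ge0 u : 0 <= dotv u u.
Proof. by apply: sumr_ge0 => i _; rewrite -expr2 sqr_ge0. Qed.

Lemma enorm_ge0 u : 0 <= enorm u.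
Proof. exact: sqrtr_ge0. Qed.

Lemma enorm_sqr u : enorm u ^+ 2 = dotv u u.
Proof. by rewrite sqr_sqrtr // dotvv_ge0. Qed.

Lemma enormZ (c : R) u : enorm (c *: u) = `|c| * enorm u.
Proof.
by rewrite /enorm dotvZl dotvZr mulrA -expr2 sqrtrM ?sqr_ge0 // sqrtr_sqr.
Qed.

Lemma enormN u : enorm (- u) = enorm u.
Proof. by rewrite -scaleN1r enormZ normrN1 mul1r. Qed.

Lemma enorm0 : enorm (0 : 'rV[R]_n) = 0.
Proof. by rewrite -(scale0r 0) enormZ normr0 mul0r. Qed.

Lemma enormC u v : enorm (u - v) = enorm (v - u).
Proof. by rewrite -enormN opprB. Qed.

Lemma enorm_le_sqrt u (r : R) : 0 <= r -> dotv u u <= r ^+ 2 -> enorm u <= r.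
Proof.
by move=> r0 ur; rewrite -(@ler_pXn2r _ 2) ?nnegrE ?enorm_ge0 // enorm_sqr.
Qed.

Lemma coord_le_enorm u i : `|u 0 i| <= enorm u.
Proof.
rewrite -sqrtr_sqr ler_wsqrtr // /dotv (bigD1 i) //= -expr2 lerDl.
by apply: sumr_ge0 => j _; rewrite -expr2 sqr_ge0.
Qed.

(** Expanding [0 <= |a u - b v|^2] for [a = |v|] and [b = |u|] gives the
inequality multiplied by [2 a b]. *)
Lemma dotv_le u v : dotv u v <= enorm u * enorm v.
Proof.
have enorm0P w : enorm w = 0 -> w = 0.
  move=> w0; apply/rowP => i; apply/eqP; rewrite mxE -normr_le0.
  by have := coord_le_enorm w i; rewrite w0.
have [/eqP/enorm0P ->|u0] := boolP (enorm u == 0).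
  by rewrite dotvC dotv0r mulr_ge0 ?enorm_ge0.
have [/eqP/enorm0P ->|v0] := boolP (enorm v == 0).
  by rewrite dotv0r mulr_ge0 ?enorm_ge0.
have uv0 : 0 < enorm u * enorm v.
  by rewrite mulr_gt0 // lt_def enorm_ge0 ?u0 ?v0.
have := dotvv_ge0 (enorm v *: u - enorm u *: v).
rewrite dotvBr !dotvZr !(dotvC (_ - _)) !dotvBr !dotvZr.
rewrite -!enorm_sqr (dotvC v u) => H.
rewrite -(ler_pM2l uv0); nra.
Qed.

Lemma norm_dotv_le u v : `|dotv u v| <= enorm u * enorm v.
Proof. by rewrite ler_norml dotv_le andbT lerNl -dotvNl -(enormN u) dotv_le. Qed.

Lemma enormD u v : enorm (u + v) <= enorm u + enorm v.
Proof.
apply: enorm_le_sqrt; first by rewrite addr_ge0 ?enorm_ge0.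
rewrite dotvDr !dotvDl (dotvC v u) -!enorm_sqr.
have := dotv_le u v; lra.
Qed.

Lemma enorm_triangle y x z : enorm (x - z) <= enorm (x - y) + enorm (y - z).
Proof. by rewrite -[x - z](subrKA y); exact: enormD. Qed.

(** The library norm on [R^n] is the sup norm, so the Euclidean norm is
equivalent to it and induces the same neighbourhoods. *)
Lemma norm_le_enorm u : `|u| <= enorm u.
Proof.
rewrite /Num.norm/= mx_normrE; apply: bigmax_le => [|[i j] _ /=].
  exact: enorm_ge0.
by rewrite (ord1 i) coord_le_enorm.
Qed.

Lemma enorm_le_norm u : enorm u <= n%:R * `|u|.
Proof.
apply: enorm_le_sqrt; first by rewrite mulr_ge0.
have -> : (n%:R * `|u|) ^+ 2 = \sum_(i < n) (n%:R * `|u| ^+ 2).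
  by rewrite sumr_const card_ord -[RHS]mulr_natl; ring.
apply: ler_sum => i _.
have ui : `|u 0 i| <= `|u|.
  rewrite {2}/Num.norm/= mx_normrE.
  exact: (le_bigmax _ (fun ij : 'I_1 * 'I_n => `|u ij.1 ij.2|) (0, i)).
have n1 : 1 <= n%:R :> R by rewrite ler1n (leq_ltn_trans _ (ltn_ord i)).
rewrite -expr2 -real_normK ?num_real //.
have := normr_ge0 (u 0 i); nra.
Qed.

Lemma nbhs_enormP x (A : set 'rV[R]_n) :
  nbhs x A <-> exists2 e : R, 0 < e & forall y, enorm (y - x) < e -> A y.
Proof.
split=> [/nbhs_ballP[e /= e0 xA]|[e e0 xA]].
  exists e => // y yx; apply: xA; rewrite -ball_normE /= distrC.
  exact: le_lt_trans (norm_le_enorm _) yx.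
apply/nbhs_ballP; exists (e / n.+1%:R) => /=; first by rewrite divr_gt0.
move=> y; rewrite -ball_normE /= distrC ltr_pdivlMr // => yx; apply: xA.
apply: le_lt_trans (enorm_le_norm _) (le_lt_trans _ yx).
by rewrite mulrC ler_wpM2l // ler_nat.
Qed.

Lemma near_enorm_lt x (e : R) : 0 < e -> \forall y \near x, enorm (y - x) < e.
Proof. by move=> e0; apply/nbhs_enormP; exists e. Qed.

Lemma cvg_enormP (x_ : nat -> 'rV[R]_n) x :
  x_ k @[k --> \oo] --> x <->
  forall e : R, 0 < e -> \forall k \near \oo, enorm (x_ k - x) < e.
Proof.
split=> [x_x e e0|H A /nbhs_enormP[e e0 eA]].
  exact: x_x (near_enorm_lt _ e0).
by apply: filterS (H e e0) => k /eA.
Qed.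

Lemma closed_eball x (r : R) : closed [set y | enorm (y - x) <= r].
Proof.
move=> y /= yx; apply/ler_addgt0Pr => e e0.
have [z [/= zx zy]] := yx _ (near_enorm_lt y e0).
have := enorm_triangle z y x; rewrite (enormC y z); lra.
Qed.

Lemma compact_eball x (r : R) : compact [set y | enorm (y - x) <= r].
Proof.
apply: bounded_closed_compact; last exact: closed_eball.
exists (r + enorm x); split; first exact: num_real.
move=> M rM y /= yx; apply: le_trans (norm_le_enorm _) _.
apply: le_trans (ltW rM); rewrite -{1}(subrK x y).
by apply: le_trans (enormD _ _) _; rewrite lerD2r.
Qed.

End Euclid.

(** * Minimisation of lower semicontinuous functions with a smooth penalty *)

(** The sets [{x in K | F x <= F y}], for [y] in [K], are nested, hence a base of
a filter; at a cluster point of it [F] cannot exceed any value [F y]. *)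
Lemma lsc_attains_min {R : realType} {T : topologicalType} (K : set T)
    (F : T -> R) :
  compact K -> K !=set0 ->
  (forall x, K x -> forall r, r < F x -> \forall y \near x, r < F y) ->
  exists2 x, K x & forall y, K y -> F x <= F y.
Proof.
move=> Kc [x0 Kx0] Flsc.
pose B y := [set x | K x /\ F x <= F y].
have BF : Filter (filter_from K B).
  apply: filter_from_filter; first by exists x0.
  move=> y z Ky Kz; have [yz|/ltW zy] := leP (F y) (F z).
    by exists y => // x [Kx xy]; split; split=> //; exact: le_trans yz.
  by exists z => // x [Kx xz]; split; split=> //; exact: le_trans zy.
have BP : ProperFilter (filter_from K B).
  by apply: filter_from_proper => y Ky; exists y; split.
have [|x [Kx xB]] := Kc _ BP; first by exists x0 => // x [].
exists x => // y Ky; rewrite leNgt; apply/negP => yx.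
have By : filter_from K B (B y) by exists y.
have [z [[_ zy] /= yz]] := xB _ _ By (Flsc _ Kx _ yx).
by have := lt_le_trans yz zy; rewrite ltxx.
Qed.

Section SmoothNorm.
Context {R : realType} {n : nat}.
Implicit Types (d : R) (z h : 'rV[R]_n).

(** The length of the vector [(z, d)] of [R^(n+1)]; for [d > 0] it is a smooth
function of [z] close to the Euclidean norm. *)
Definition snorm d z : R := Num.sqrt (dotv z z + d ^+ 2).

Lemma snorm_sqr d z : snorm d z ^+ 2 = dotv z z + d ^+ 2.
Proof. by rewrite sqr_sqrtr // addr_ge0 ?dotvv_ge0 ?sqr_ge0. Qed.

Lemma snorm_ge d z : 0 <= d -> d <= snorm d z.
Proof.
move=> d0; rewrite -(@ler_pXn2r _ 2) ?nnegrE ?sqrtr_ge0 // snorm_sqr.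
by rewrite lerDr dotvv_ge0.
Qed.

Lemma snorm0 d : 0 <= d -> snorm d 0 = d.
Proof. by move=> d0; rewrite /snorm dotv0r add0r sqrtr_sqr ger0_norm. Qed.

Lemma enorm_lt_snorm d z : 0 < d -> enorm z < snorm d z.
Proof.
move=> d0; rewrite -(@ltr_pXn2r _ 2) ?nnegrE ?sqrtr_ge0 // snorm_sqr enorm_sqr.
by rewrite ltrDl exprn_gt0.
Qed.

Lemma snormD_le d z h : snorm d (z + h) <= snorm d z + enorm h.
Proof.
have s0 : 0 <= snorm d z by exact: sqrtr_ge0.
have zs : enorm z <= snorm d z.
  by apply: enorm_le_sqrt; rewrite // snorm_sqr lerDl sqr_ge0.
rewrite -(@ler_pXn2r _ 2) ?nnegrE ?sqrtr_ge0 ?addr_ge0 ?enorm_ge0 //.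
rewrite snorm_sqr sqrrD snorm_sqr dotvDr !dotvDl (dotvC h z) -!enorm_sqr.
have := dotv_le z h; have := enorm_ge0 h; nra.
Qed.

(** The tangent bound [sqrt t <= s + (t - s^2) / (2 s)] of the concave square
root at [s^2], for [s = snorm d z] and [t = (snorm d (z + h))^2]. *)
Lemma snorm_tangent d z h : 0 < d ->
  snorm d (z + h) <= snorm d z + dotv ((snorm d z)^-1 *: z) h
                     + (2 * snorm d z)^-1 * enorm h ^+ 2.
Proof.
move=> d0; have s0 : 0 < snorm d z := lt_le_trans d0 (snorm_ge _ (ltW d0)).
rewrite dotvZl; set s := snorm d z in s0 *; set t := snorm d (z + h).
have tE : t ^+ 2 = s ^+ 2 + 2 * dotv z h + enorm h ^+ 2.
  rewrite /t /s !snorm_sqr enorm_sqr dotvDr !dotvDl (dotvC h z); ring.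
have -> : s + s^-1 * dotv z h + (2 * s)^-1 * enorm h ^+ 2
    = (s ^+ 2 + t ^+ 2) / (2 * s) by rewrite tE; field; rewrite gt_eqF.
by rewrite ler_pdivlMr ?mulr_gt0 //; have := sqr_ge0 (s - t); nra.
Qed.

End SmoothNorm.

Section Slopes.
Context {R : realType} {n : nat}.
Implicit Types (g : 'rV[R]_n -> \bar R) (x y xb w : 'rV[R]_n).

(** The hypothesis says that [g + l * snorm d (. - z)] has a local minimum at
[x].  As the penalty lies below its tangent up to a quadratic term, the
negative of its gradient, whose norm is at most [l], supports [g] at [x]. *)
Lemma regular_subdiff_smooth_penalty g x z (l d : R) :
  0 < l -> 0 < d -> g x \is a fin_num ->
  (\forall y \near x,
    (g x + (l * (snorm d (x - z) - snorm d (y - z)))%:E <= g y)%E) ->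
  exists2 w, regular_subdiff g x w & enorm w <= l.
Proof.
move=> l0 d0 gx xmin; set s := snorm d (x - z).
have s0 : 0 < s := lt_le_trans d0 (snorm_ge _ (ltW d0)).
exists (- (l / s) *: (x - z)); last first.
  rewrite enormZ normrN gtr0_norm ?divr_gt0 // -mulrA ler_piMr //.
    exact: ltW.
  by rewrite mulrC ler_pdivrMr // mul1r; exact/ltW/enorm_lt_snorm.
split=> // e e0.
have r0 : 0 < e * (2 * s) / l by rewrite !(divr_gt0, mulr_gt0).
apply: filterS2 xmin (near_enorm_lt x r0) => y gy yx.
apply: le_trans gy; apply: leeD2l; rewrite lee_fin.
have := snorm_tangent (x - z) (y - x) d0; rewrite -/s.
rewrite [x - z + _]addrC subrKA !dotvZl => H.
have e2 : (2 * s)^-1 * enorm (y - x) ^+ 2 * l <= e * enorm (y - x).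
  rewrite ltr_pdivlMr // in yx.
  have -> : (2 * s)^-1 * enorm (y - x) ^+ 2 * l =
    enorm (y - x) * (enorm (y - x) * l / (2 * s)).
    by field; rewrite gt_eqF.
  rewrite [e * _]mulrC ler_wpM2l ?enorm_ge0 // ler_pdivrMr ?mulr_gt0 //.
  exact: ltW.
have -> : - (l / s) * dotv (x - z) (y - x) =
   - (l * (s^-1 * dotv (x - z) (y - x))) by rewrite mulNr -mulrA.
nra.
Qed.

End Slopes.

(** * Slopes and growth of sublevel sets *)

Section LevelSets.
Context {R : realType} {n : nat}.
Implicit Types (g : 'rV[R]_n -> \bar R) (x y xb w : 'rV[R]_n).

Definition sublevel g (a : R) : set 'rV[R]_n := [set x | (g x <= a%:E)%E].

(** What local lower semicontinuity provides at the points around [xb]: lower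
semicontinuity in the usual sense, but only up to the level [g xb + e]. *)
Definition lsc_near g xb (e : R) := forall x, enorm (x - xb) < e ->
  forall r : R, (r%:E < g xb + e%:E)%E -> (r%:E < g x)%E ->
  \forall y \near x, (r%:E < g y)%E.

(** Moving from [x], where [g x = t], to the sublevel set of [a < t] takes a step
of length at most [k (t - a)], along which a regular subgradient [w] forces
[t - a <= (|w| + e) k (t - a)], where [e] is arbitrarily small once [a] is close
to [t]. *)
Lemma inclusion_slope_ge g xb (c k : R) : 0 <= k ->
  lipschitz_inclusion (sublevel g) [set a | (c%:E <= a%:E)%E] c xb k ->
  exists2 e : R, 0 < e &
    forall x w, enorm (x - xb) < e -> (c%:E < g x)%E -> (g x < (c + e)%:E)%E ->
      regular_subdiff g x w -> 1 <= k * enorm w.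
Proof.
move=> k0 [V [W [/nbhs_ballP[e1 /= e10 Ve] /nbhs_enormP[e2 e20 We] incl]]].
exists (Num.min e1 e2) => [|x w xxb cg gce [gx wsub]].
  by rewrite lt_min e10.
have [xe1 xe2] : enorm (x - xb) < e1 /\ enorm (x - xb) < e2.
  by move: xxb; rewrite lt_min => /andP[].
move: gx cg gce wsub; case E : (g x) => [t| |] //= _.
rewrite !lte_fin => ct tce wsub; rewrite leNgt; apply/negP => kw.
have te1 : t < c + e1.
  by apply: lt_le_trans tce _; rewrite lerD2l ge_min lexx.
have k1 : 0 < k + 1 by rewrite ltr_wpDl.
(* the slack in [k * enorm w < 1], so that [k * (enorm w + e) < 1] still holds *)
pose e := (1 - k * enorm w) / (k + 1).
have e0 : 0 < e by rewrite divr_gt0 // subr_gt0.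
have kwe : k * (enorm w + e) < 1.
  have : e * (k + 1) = 1 - k * enorm w by rewrite /e divfK // gt_eqF.
  nra.
have /nbhs_enormP[r r0 xr] := wsub e e0.
(* by [k * (t - a) < r], [incl] provides a point where [w] supports [g] *)
pose a := Num.max c (t - r / (k + 1)).
have at_ : a < t by rewrite gt_max ct ltrBlDr ltrDl divr_gt0.
have ta : k * (t - a) < r.
  have : t - a <= r / (k + 1).
    by rewrite lerBlDr addrC -lerBlDr le_max lexx orbT.
  rewrite ler_pdivlMr // => H.
  apply: lt_le_trans H; rewrite mulrC ltr_pM2l ?subr_gt0 //; lra.
have ca : c <= a by rewrite le_max lexx.
have Va : V a by apply: Ve; rewrite /ball /= ltr_distlC; lra.
have Vt : V t by apply: Ve; rewrite /ball /= ltr_distlC; lra.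
have [|||u ua [b b1 xE]] := incl a t _ _ x.
- by split => //=; rewrite lee_fin.
- by split => //=; rewrite lee_fin ltW.
- by split; [rewrite /sublevel /= E | exact: We].
have ux : enorm (u - x) <= k * (t - a).
  rewrite -xE opprD addNKr enormN enormZ normrM normr_id ger0_norm //.
  rewrite gtr0_norm ?subr_gt0 // ler_piMr // mulr_ge0 // subr_ge0.
  exact: ltW.
have := le_trans (xr u (le_lt_trans ux ta)) ua.
rewrite -EFinD lee_fin.
have := dotv_le (- w) (u - x); rewrite dotvNl enormN.
have := enorm_ge0 (u - x); have := enorm_ge0 w.
move: kwe ux at_ e0; move: (enorm w) (enorm (u - x)) (dotv w _) => N M D.
move=> kwe ux at_ e0 N0 M0 D1 D2.
have : t - a <= (N + e) * M by nra.
have : (N + e) * M <= (N + e) * (k * (t - a)).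
  by apply: ler_wpM2l => //; lra.
have : (N + e) * (k * (t - a)) < t - a.
  by rewrite mulrA [(_ + _) * k]mulrC gtr_pMl // subr_gt0.
lra.
Qed.

(** A point [x'] at which the inclusion fails for the levels [a < a'] is far from
the sublevel set of [a] compared with [a' - a].  The subgradient is found at a
minimiser of [max (g, a)] plus a penalty of slope at most [1/l] centred at
[x']. *)
Lemma not_inclusion_slope_le g xb (c k l e : R) : g xb = c%:E ->
  0 < e -> lsc_near g xb e -> 0 < l -> l < k ->
  ~ lipschitz_inclusion (sublevel g) [set a | (c%:E <= a%:E)%E] c xb k ->
  exists x w, [/\ enorm (x - xb) < e, (c%:E < g x)%E, (g x < (c + e)%:E)%E,
    regular_subdiff g x w & enorm w <= l^-1].
Proof.
move=> gxb e0 glsc l0 lk Nincl.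
have k0 : 0 < k := lt_trans l0 lk.
(* [d] leaves room for a step of length [k * d] from the ball of radius [d] *)
pose d := e / (k + 1).
have d0 : 0 < d by rewrite divr_gt0 // addr_gt0.
have dE : k * d + d = e.
  by rewrite -[X in _ + X]mul1r -mulrDl /d mulrC divfK // gt_eqF ?addr_gt0.
(* monotonicity of the sublevel sets excludes [a' <= a] in a failing inclusion *)
have [a [a' [x' [ca ad aa' ad' [xa' xd Nx']]]]] : exists a a' x',
  [/\ c <= a, a < c + d, a < a', a' < c + d & [/\ (g x' <= a'%:E)%E,
    enorm (x' - xb) < d &
    forall u, (g u <= a%:E)%E -> ~ enorm (u - x') <= k * (a' - a)]].
  apply: contrapT => H; apply: Nincl.
  exists (ball c d), [set x | enorm (x - xb) < d]; split.
  - exact: nbhsx_ballx.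
  - exact: near_enorm_lt.
  - move=> a a' [/=]; rewrite !lee_fin /ball /= => ca cad [ca' cad'] x' [xa' xd].
    have [a'a|aa'] := leP a' a.
      exists x'; first by apply: le_trans xa' _; rewrite lee_fin.
      by exists 0; rewrite /= /eball /= ?enorm0 ?scaler0 ?addr0.
    apply: contrapT => Nx'; apply: H; exists a, a', x'; split => //.
    - by move: cad; rewrite ltr_distlC; lra.
    - by move: cad'; rewrite ltr_distlC; lra.
    split => // u ua ux; apply: Nx'; exists u => //.
    have r0 : 0 < k * `|a' - a|.
      by rewrite mulr_gt0 // gtr0_norm subr_gt0.
    exists ((k * `|a' - a|)^-1 *: (x' - u)).
      rewrite /eball /= enormZ gtr0_norm ?invr_gt0 // mulrC ler_pdivrMr //.
      by rewrite mul1r enormC gtr0_norm ?subr_gt0.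
    by rewrite scalerA divff ?gt_eqF // scale1r addrC subrK.
pose h := a' - a.
have h0 : 0 < h by rewrite subr_gt0.
have hd : h < d by rewrite /h; lra.
(* as [l * h + m = k * h], points where the penalty exceeds its value at [x'] by
   at most [h] are at distance less than [k * h] from [x'] *)
pose m := (k - l) * h.
have m0 : 0 < m by rewrite mulr_gt0 // subr_gt0.
pose K := [set y | enorm (y - x') <= k * h].
have Kin y : K y -> enorm (y - xb) < e.
  move=> Ky; have /= := enorm_triangle x' y xb.
  have : k * h < k * d by rewrite ltr_pM2l.
  rewrite /K /= in Ky; lra.
(* truncating above at [c + e] makes the function finite, and its lower
   semicontinuity then follows from that of [g] below this level *)
pose G y := fine (mine (maxe (g y) a%:E) (c + e)%:E).
have ace : a < c + e.
  apply: lt_trans ad _; rewrite ltrD2l -dE ltrDr mulr_gt0 //.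
have GE y : (G y)%:E = mine (maxe (g y) a%:E) (c + e)%:E.
  rewrite /G fineK //; case: (g y) => [t| |].
  - by rewrite -EFin_max -EFin_min.
  - by rewrite maxye minye.
  - by rewrite maxNye -EFin_min.
have Gge y : a <= G y.
  by rewrite -lee_fin GE le_min le_max lexx orbT lee_fin ltW.
have Gle y : (a%:E < g y)%E -> ((G y)%:E <= g y)%E.
  by move=> ay; rewrite GE ge_min ge_max lexx ltW.
pose F y := G y + l^-1 * snorm m (y - x').
have li0 : 0 < l^-1 by rewrite invr_gt0.
have [||y Ky r rF|x Kx xmin] := @lsc_attains_min R _ K F.
- exact: compact_eball.
- by exists x'; rewrite /K /= subrr enorm0 mulr_ge0 // ltW.
- pose s := F y - r; have s0 : 0 < s by rewrite subr_gt0.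
  have Glsc : \forall z \near y, G y - s / 2 < G z.
    have [Ha|Ha] := ltP (G y - s / 2) a.
      by apply: filterE => z; exact: lt_le_trans (Gge z).
    have Gys : ((G y - s / 2)%:E < (G y)%:E)%E.
      by rewrite lte_fin ltrBlDr ltrDl divr_gt0.
    move: (Gys); rewrite GE lt_min lt_max [X in _ || X]lte_fin (ltNge _ a) Ha.
    rewrite orbF => /andP[gys ces].
    have := glsc y (Kin _ Ky) _ _ gys; rewrite gxb -EFinD => /(_ ces).
    apply: filterS => z gz.
    by rewrite -lte_fin GE lt_min lt_max gz.
  have r0 : 0 < l * (s / 2) by rewrite mulr_gt0 // divr_gt0.
  apply: filterS2 Glsc (near_enorm_lt y r0) => z Gz zy.
  have := snormD_le m (z - x') (y - z).
  rewrite [z - x' + _]addrC subrKA enormC => H.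
  have : l^-1 * snorm m (y - x') < l^-1 * snorm m (z - x') + s / 2.
    rewrite -(ltr_pM2l l0) mulrDr !mulrA !divff ?gt_eqF // !mul1r -mulrA.
    lra.
  rewrite /F; move: Gz; rewrite /s /F; lra.
have Gx' : G x' <= a'.
  by rewrite -lee_fin GE ge_min ge_max xa' lee_fin ltW.
have Fx : F x <= a' + l^-1 * m.
  apply: le_trans (xmin x' _) _.
    by rewrite /K /= subrr enorm0 mulr_ge0 // ltW.
  by rewrite /F subrr snorm0 ?(ltW m0) // lerD2r.
have sm : m <= snorm m (x - x') by exact/snorm_ge/ltW.
have xh : enorm (x - x') < k * h.
  apply: lt_le_trans (enorm_lt_snorm _ m0) _.
  have : l^-1 * snorm m (x - x') <= h + l^-1 * m.
    by have := Gge x; move: Fx; rewrite /F /h; lra.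
  rewrite -(ler_pM2l l0) mulrDr !mulrA !divff ?gt_eqF // !mul1r /m; lra.
have gxa : (a%:E < g x)%E.
  by rewrite ltNge; apply/negP => /Nx'; apply; exact: ltW.
have Gxa' : G x <= a'.
  have : l^-1 * m <= l^-1 * snorm m (x - x') by rewrite ler_pM2l.
  move: Fx; rewrite /F; lra.
have a'ce : a' < c + e.
  apply: lt_trans ad' _; rewrite ltrD2l -dE ltrDr mulr_gt0 //.
have gx : g x = (G x)%:E.
  rewrite GE; move: Gxa'; rewrite -lee_fin GE (max_idPl (ltW gxa)) ge_min.
  rewrite [X in _ || X]lee_fin (leNgt (c + e)) a'ce orbF => gxa'.
  by rewrite (min_idPl _) // (le_trans gxa') // lee_fin ltW.
have [||w wx wl] := @regular_subdiff_smooth_penalty _ _ g x x' l^-1 m li0 m0.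
- by rewrite gx.
- have xK : \forall y \near x, K y.
    have r0 : 0 < k * h - enorm (x - x') by rewrite subr_gt0.
    apply: filterS (near_enorm_lt x r0) => y yx.
    by have := enorm_triangle x y x'; rewrite /K /=; lra.
  have xa : \forall y \near x, (a%:E < g y)%E.
    by apply: glsc gxa; [exact: Kin|rewrite gxb -EFinD lte_fin].
  apply: filterS2 xK xa => y Ky ya; apply: le_trans (Gle _ ya).
  by rewrite gx -EFinD lee_fin; have := xmin y Ky; rewrite /F; lra.
exists x, w; split => //.
- exact: Kin.
- by apply: le_lt_trans gxa; rewrite lee_fin.
- by rewrite gx lte_fin (le_lt_trans Gxa').
Qed.

End LevelSets.

(** * The outer limiting subdifferential through the tilted function *)

Section Outer.
Context {R : realType} {n : nat}.
Implicit Types (f g : 'rV[R]_n -> \bar R) (x y xb v w vb : 'rV[R]_n).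

Lemma ereal_between (a : R) (z : \bar R) : (a%:E < z)%E ->
  exists2 s : R, a < s & (s%:E < z)%E.
Proof.
case: z => [t| |] //; rewrite ?lte_fin => at_.
- by exists ((a + t) / 2); rewrite ?lte_fin; lra.
- by exists (a + 1); rewrite ?ltry ?ltrDl.
Qed.

Lemma cvg_EFinP (u : nat -> \bar R) (t : R) : (forall k, u k \is a fin_num) ->
  (u k @[k --> \oo] --> t%:E) <->
  (forall e : R, 0 < e ->
     \forall k \near \oo, ((t - e)%:E < u k < (t + e)%:E)%E).
Proof.
move=> ufin; have distE k e : ((t - e)%:E < u k < (t + e)%:E)%E =
    (`|t - fine (u k)| < e).
  by rewrite ltr_distlC -!lte_fin fineK.
split=> [/fine_cvgP[_ /cvgrPdist_lt ut] e e0|ut].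
  by apply: filterS (ut e e0) => k; rewrite distE.
apply/fine_cvgP; split; first exact: filterE.
by apply/cvgrPdist_lt => e e0; apply: filterS (ut e e0) => k; rewrite distE.
Qed.

Definition tilt f vb xb x : \bar R := (f x - (dotv vb (x - xb))%:E)%E.

Lemma tilt_fin_num f vb xb x :
  (tilt f vb xb x \is a fin_num) = (f x \is a fin_num).
Proof. by rewrite /tilt; case: (f x). Qed.

Lemma tilt_center f vb xb : tilt f vb xb xb = f xb.
Proof. by rewrite /tilt subrr dotv0r sube0. Qed.

Lemma lsc_near_tilt f vb xb : f xb \is a fin_num -> locally_lsc_at f xb ->
  exists2 e : R, 0 < e & lsc_near (tilt f vb xb) xb e.
Proof.
rewrite /lsc_near tilt_center.
case fxb : (f xb) => [c| |] // _ [e0 e00 fcl].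
have V1 : 0 < enorm vb + 1 by rewrite ltr_wpDl ?enorm_ge0.
have V2 : 0 < enorm vb + 2 by rewrite ltr_wpDl ?enorm_ge0.
pose e := e0 / (enorm vb + 2).
have eE : e * (enorm vb + 2) = e0 by rewrite divfK // gt_eqF.
have ep : 0 < e by rewrite divr_gt0.
have V0 := enorm_ge0 vb.
exists e => // x xe r; rewrite -EFinD lte_fin /tilt lteBrDr // => rce rx.
have px : dotv vb (x - xb) <= enorm vb * e.
  apply: le_trans (dotv_le _ _) _; rewrite ler_wpM2l //; exact: ltW.
have [s rs sf] : exists2 s : R, r + dotv vb (x - xb) < s &
    (s%:E < mine (f x) (c + e0)%:E)%E.
  apply: ereal_between; rewrite lt_min -EFinD in rx *; rewrite rx lte_fin; nra.
move: sf; rewrite lt_min lte_fin => /andP[sf sc].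
have /fcl/closed_openC fop : (s%:E <= f xb + e0%:E)%E.
  by rewrite fxb -EFinD lee_fin ltW.
have Nx : (~` [set z | enorm (z - xb) <= e0 /\ (f z <= s%:E)%E]) x.
  by move=> [_] /=; rewrite leNgt sf.
pose q := s - (r + dotv vb (x - xb)).
have q0 : 0 < q / (enorm vb + 1) by rewrite divr_gt0 // subr_gt0.
have e0x : 0 < e0 - enorm (x - xb) by rewrite subr_gt0; nra.
apply: filterS3 (open_nbhs_nbhs (conj fop Nx)) (near_enorm_lt x q0)
  (near_enorm_lt x e0x) => y Ny yq ye.
have {}Ny : (s%:E < f y)%E.
  rewrite ltNge; apply/negP => fy; apply: Ny; split => //=.
  by have := enorm_triangle x y xb; lra.
rewrite lteBrDr //; apply: lt_trans Ny; rewrite -EFinD lte_fin.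
rewrite ltr_pdivlMr // in yq.
have := dotv_le vb (y - x); have := enorm_ge0 (y - x).
have yxE : (y - xb) - (x - xb) = y - x by rewrite opprB addrA subrK.
rewrite -{2}yxE dotvBr.
rewrite /q in yq; lra.
Qed.

Lemma regular_subdiff_tilt f vb xb x w :
  regular_subdiff (tilt f vb xb) x w <-> regular_subdiff f x (w + vb).
Proof.
suff E y e : f x \is a fin_num ->
  (tilt f vb xb x + (dotv w (y - x) - e * enorm (y - x))%:E
     <= tilt f vb xb y)%E =
  (f x + (dotv (w + vb) (y - x) - e * enorm (y - x))%:E <= f y)%E.
  rewrite /regular_subdiff /= tilt_fin_num.
  by split=> -[fx H]; split=> // e /H; apply: filterS => y; rewrite E.
rewrite /tilt => fx; rewrite leeBrDr // dotvDl.
rewrite -(fineK fx) -EFinB -!EFinD; congr ((_%:E <= _)%E).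
have -> : y - x = (y - xb) - (x - xb) by rewrite opprB addrA subrK.
by rewrite !(dotvBr vb); ring.
Qed.

Lemma cvg_dotv_shift (x_ : nat -> 'rV[R]_n) x vb xb :
  x_ k @[k --> \oo] --> x ->
  dotv vb (x_ k - xb) @[k --> \oo] --> dotv vb (x - xb).
Proof.
move=> /cvg_enormP x_x; apply/cvgrPdist_lt => e e0.
have V1 : 0 < enorm vb + 1 by rewrite ltr_wpDl ?enorm_ge0.
apply: filterS (x_x _ (divr_gt0 e0 V1)) => k.
rewrite ltr_pdivlMr // -dotvBr opprB addrA subrK => H.
apply: le_lt_trans (norm_dotv_le _ _) _; rewrite enormC.
have := enorm_ge0 (x_ k - x); lra.
Qed.

Lemma cvg_tilt f vb xb (x_ : nat -> 'rV[R]_n) x : f x \is a fin_num ->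
  x_ k @[k --> \oo] --> x ->
  (f (x_ k) @[k --> \oo] --> f x <->
   tilt f vb xb (x_ k) @[k --> \oo] --> tilt f vb xb x).
Proof.
move=> fx x_x; have px := cvg_dotv_shift (vb := vb) (xb := xb) x_x.
have px' : (dotv vb (x_ k - xb))%:E @[k --> \oo] --> (dotv vb (x - xb))%:E.
  by apply: cvg_EFin => //; exact: filterE.
split=> H.
  by apply: cvgeB px' => //; rewrite fin_num_adde_defl.
have fE y : f y = (tilt f vb xb y + (dotv vb (y - xb))%:E)%E by rewrite subeK.
rewrite (_ : (fun k => f (x_ k)) =
  (fun k => tilt f vb xb (x_ k) + (dotv vb (x_ k - xb))%:E)%E); last first.
  by apply/funext => k.
by rewrite fE; apply: cvgeD px' => //; rewrite fin_num_adde_defl.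
Qed.

(** A double limit is traded for a single approximation: limiting subgradients
at [x_k] are replaced by regular subgradients at points so close to [x_k] that
the strict inequality defining the outer subdifferential survives. *)
Lemma outer_limiting_subdiffP f vb xb v (c : R) : f xb = c%:E ->
  outer_limiting_subdiff f vb xb v <->
  forall e : R, 0 < e -> exists x w,
    [/\ enorm (x - xb) < e, (c%:E < tilt f vb xb x)%E,
        (tilt f vb xb x < (c + e)%:E)%E,
        regular_subdiff (tilt f vb xb) x w & enorm (w + vb - v) < e].
Proof.
move=> fxb; have fxbf : f xb \is a fin_num by rewrite fxb.
have gxb : tilt f vb xb xb = c%:E by rewrite tilt_center.
split.
  move=> [x_ [v_ [x_x fx_ fgt vsub v_v]]] e e0.
  have e2 : 0 < e / 2 by rewrite divr_gt0.
  have gfin k : tilt f vb xb (x_ k) \is a fin_num.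
    by rewrite tilt_fin_num; have [] := vsub k.
  move: fx_ => /(@cvg_tilt f vb xb _ _ fxbf x_x).
  rewrite gxb => /(cvg_EFinP _ gfin).
  move=> /(_ _ e2) gx_.
  move/cvg_enormP: x_x => /(_ _ e2) x_x.
  move/cvg_enormP: v_v => /(_ _ e2) v_v.
  have [k [xk gk vk]] : exists k, [/\ enorm (x_ k - xb) < e / 2,
      (tilt f vb xb (x_ k) < (c + e / 2)%:E)%E & enorm (v_ k - v) < e / 2].
    have [k] := @filter_ex _ \oo _ _ (filterI x_x (filterI gx_ v_v)).
    by move=> [? [/andP[_ ?] ?]]; exists k.
  have [fkfin [y_ [w_ [y_x fy wsub w_v]]]] := vsub k.
  have gk0 : (c%:E < tilt f vb xb (x_ k))%E by rewrite lteBrDr // -fxb fgt.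
  have gyfin j : tilt f vb xb (y_ j) \is a fin_num.
    by rewrite tilt_fin_num; have [] := wsub j.
  move: fy => /(@cvg_tilt f vb xb _ _ fkfin y_x).
  move: gk gk0 (gfin k); case: (tilt f vb xb (x_ k)) => // t.
  rewrite !lte_fin => tce ct _ /(cvg_EFinP _ gyfin) => gy.
  have d0 : 0 < Num.min (t - c) (e / 2) by rewrite lt_min subr_gt0 ct.
  have {}gy := gy _ d0.
  move/cvg_enormP: y_x => /(_ _ e2) y_x.
  move/cvg_enormP: w_v => /(_ _ e2) w_v.
  have [j [yj [/andP[gj1 gj2] wj]]] :=
    @filter_ex _ \oo _ _ (filterI y_x (filterI gy w_v)).
  exists (y_ j), (w_ j - vb); split.
  - by have := enorm_triangle (x_ k) (y_ j) xb; lra.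
  - apply: le_lt_trans gj1; rewrite lee_fin lerBrDr addrC -lerBrDr.
    by rewrite ge_min lexx.
  - apply: lt_le_trans gj2 _; rewrite lee_fin.
    have : Num.min (t - c) (e / 2) <= e / 2 by rewrite ge_min lexx orbT.
    lra.
  - by apply/regular_subdiff_tilt; rewrite subrK.
  - by rewrite subrK; have := enorm_triangle (v_ k) (w_ j) v; lra.
move=> H.
have inv0 k : 0 < k.+1%:R^-1 :> R by rewrite invr_gt0.
have {}H k : exists xw : 'rV[R]_n * 'rV[R]_n,
    [/\ enorm (xw.1 - xb) < k.+1%:R^-1, (c%:E < tilt f vb xb xw.1)%E,
        (tilt f vb xb xw.1 < (c + k.+1%:R^-1)%:E)%E,
        regular_subdiff (tilt f vb xb) xw.1 xw.2 &
        enorm (xw.2 + vb - v) < k.+1%:R^-1].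
  by have [x [w ?]] := H _ (inv0 k); exists (x, w).
have [xw Hxw] := choice H.
have small (e : R) : 0 < e -> \forall k \near \oo, k.+1%:R^-1 < e.
  by move=> e0; have := near_infty_natSinv_lt (PosNum e0).
have x_x : (xw k).1 @[k --> \oo] --> xb.
  apply/cvg_enormP => e /small; apply: filterS => k; apply: lt_trans.
  by have [] := Hxw k.
exists (fun k => (xw k).1), (fun k => (xw k).2 + vb); split => //.
- apply/(@cvg_tilt f vb xb _ _ fxbf x_x); rewrite gxb.
  apply/cvg_EFinP => [k|e e0].
    by rewrite tilt_fin_num; have [_ _ _ /regular_subdiff_tilt[]] := Hxw k.
  apply: filterS (small e e0) => k ke; have [_ cg gc _ _] := Hxw k.
  apply/andP; split; first by apply: lt_trans cg; rewrite lte_fin ltrBlDr ltrDl.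
  by apply: lt_trans gc _; rewrite lte_fin ltrD2l.
- by move=> k; have [_ cg _ _ _] := Hxw k; rewrite fxb -lteBrDr.
- move=> k; have [_ _ _ /regular_subdiff_tilt ws _] := Hxw k.
  have [fx _] := ws; split=> //.
  exists (fun=> (xw k).1), (fun=> (xw k).2 + vb); split => //; exact: cvg_cst.
- apply/cvg_enormP => e /small; apply: filterS => k; apply: lt_trans.
  by have [] := Hxw k.
Qed.

(** The bound [M] keeps the subgradients in a compact ball; a cluster point of
them, for [e] tending to [0], is an outer limiting subgradient. *)
Lemma outer_limiting_subdiff_bounded f vb xb (c M : R) : f xb = c%:E ->
  (forall e : R, 0 < e -> exists x w,
    [/\ enorm (x - xb) < e, (c%:E < tilt f vb xb x)%E,
        (tilt f vb xb x < (c + e)%:E)%E,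
        regular_subdiff (tilt f vb xb) x w & enorm w <= M]) ->
  exists2 v, outer_limiting_subdiff f vb xb v & enorm (v - vb) <= M.
Proof.
move=> fxb H.
pose B (e : R) := [set w | enorm w <= M /\ exists x,
  [/\ enorm (x - xb) < e, (c%:E < tilt f vb xb x)%E,
      (tilt f vb xb x < (c + e)%:E)%E & regular_subdiff (tilt f vb xb) x w]].
have Bmono e e' : e <= e' -> B e `<=` B e'.
  move=> ee' w [wM [x [? ? ge ?]]]; split=> //; exists x; split => //.
    exact: lt_le_trans ee'.
  by apply: lt_le_trans ge _; rewrite lee_fin lerD2l.
pose F := filter_from [set e : R | 0 < e] B.
have FF : Filter F.
  apply: filter_from_filter; first by exists 1 => /=.
  move=> e e' e0 e'0; exists (Num.min e e'); first by rewrite /= lt_min e0.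
  by move=> w Bw; split; apply: Bmono Bw; rewrite ge_min lexx ?orbT.
have PF : ProperFilter F.
  apply: filter_from_proper => e /H[x [w [? ? ? ? ?]]].
  by exists w; split=> //; exists x.
have [|w [wM wcl]] := @compact_eball R n 0 M F PF.
  by exists 1 => [/=|w [wM _]]; rewrite // /= subr0.
exists (w + vb); last by rewrite addrK; rewrite /= subr0 in wM.
apply/(outer_limiting_subdiffP _ _ fxb) => e e0.
have FB : F (B e) by exists e.
have [w' [[_ [x [? ? ? ?]]] w'w]] := wcl _ _ FB (near_enorm_lt w e0).
exists x, w'; split => //.
by rewrite opprD addrACA subrr addr0.
Qed.

End Outer.

(** * The modulus of the level-set mapping *)

Section Modulus.
Context {R : realType} {n : nat}.
Context (f : 'rV[R]_n -> \bar R) (xb vb : 'rV[R]_n) (c : R).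
Context (fxb : f xb = c%:E) (f_lsc : locally_lsc_at f xb).

Let S := level_set f vb xb.
Let X := [set a : R | (c%:E <= a%:E)%E].
Let D := outer_limiting_subdiff f vb xb.

Let fxb_fin : f xb \is a fin_num.
Proof. by rewrite fxb. Qed.

Lemma inclusion_dist_ge (k : R) v : 0 <= k -> lipschitz_inclusion S X c xb k ->
  D v -> 1 <= k * enorm (v - vb).
Proof.
move=> k0 incl /(outer_limiting_subdiffP _ _ fxb) vD.
have [e e0 slope] := @inclusion_slope_ge _ _ (tilt f vb xb) xb c k k0 incl.
apply/ler_addgt0Pr => r r0.
have r1 : 0 < Num.min e (r / (k + 1)) by rewrite lt_min e0 divr_gt0 // ltr_wpDl.
have [x [w [xe cg gc wsub wv]]] := vD _ r1.
move: xe wv; rewrite !lt_min => /andP[xe _] /andP[_].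
rewrite ltr_pdivlMr ?ltr_wpDl // => wv.
have gce : (tilt f vb xb x < (c + e)%:E)%E.
  by apply: lt_le_trans gc _; rewrite lee_fin lerD2l ge_min lexx.
have := slope x w xe cg gce wsub.
have := enormD (w + vb - v) (v - vb).
rewrite addrA subrK addrK.
have := enorm_ge0 (w + vb - v); nra.
Qed.

(** Otherwise the tilt of [f] would have regular subgradients of norm at most
[l^-1] at points arbitrarily close to [xb], and [f] would have an outer limiting
subgradient at distance at most [l^-1] from [vb]. *)
Lemma inclusion_of_lt_dist (l k : R) : 0 < l -> l < k ->
  (forall v, D v -> l^-1 < enorm (v - vb)) -> lipschitz_inclusion S X c xb k.
Proof.
move=> l0 lk Dl; apply: contrapT => Nincl.
have [e0 e00 glsc] := @lsc_near_tilt _ _ f vb xb fxb_fin f_lsc.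
have gxb : tilt f vb xb xb = c%:E by rewrite tilt_center.
have [|v Dv] := @outer_limiting_subdiff_bounded _ _ f vb xb c l^-1 fxb;
  last by rewrite leNgt Dl.
move=> e e_gt0; have m0 : 0 < Num.min e e0 by rewrite lt_min e_gt0.
have mlsc : lsc_near (tilt f vb xb) xb (Num.min e e0).
  move=> x; rewrite lt_min => /andP[_ xe0] r; rewrite gxb -EFinD lte_fin => rc.
  apply: (glsc x xe0 r); rewrite gxb -EFinD lte_fin.
  by apply: lt_le_trans rc _; rewrite lerD2l ge_min lexx orbT.
have [x [w [xe cg gc ws wl]]] :=
  not_inclusion_slope_le gxb m0 mlsc l0 lk Nincl.
exists x, w; split => //; first by move: xe; rewrite lt_min => /andP[].
by apply: lt_le_trans gc _; rewrite lee_fin lerD2l ge_min lexx.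
Qed.

(** The outer limiting subdifferential is closed, so [vb] has a positive distance
to it. *)
Lemma notin_outer_inclusion : ~ D vb ->
  exists2 k : R, 0 <= k & lipschitz_inclusion S X c xb k.
Proof.
move=> NDvb.
have [e e0 He] : exists2 e : R, 0 < e & forall v, D v -> e <= enorm (v - vb).
  apply: contrapT => H; apply: NDvb.
  apply/(outer_limiting_subdiffP _ _ fxb) => e e0.
  have e2 : 0 < e / 2 by rewrite divr_gt0.
  have [v Dv vvb] : exists2 v, D v & enorm (v - vb) < e / 2.
    apply: contrapT => Nv; apply: H; exists (e / 2) => // v Dv.
    by rewrite leNgt; apply/negP => ve; apply: Nv; exists v.
  move/(outer_limiting_subdiffP _ _ fxb)/(_ _ e2): Dv.
  move=> [x [w [xe cg gc ws wv]]]; exists x, w; split => //; first lra.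
    by apply: lt_trans gc _; rewrite lte_fin; lra.
  by have := enorm_triangle v (w + vb) vb; lra.
have i0 : 0 < (e / 2)^-1 by rewrite invr_gt0 divr_gt0.
exists ((e / 2)^-1 + 1); first by rewrite addr_ge0 // ltW.
apply: (inclusion_of_lt_dist i0); first by rewrite ltrDl.
by move=> v /He; rewrite invrK; lra.
Qed.

Lemma modulus_eq : graphical_modulus S X c xb = ((dist_to_set vb D)^-1)%E.
Proof.
have dist_ge0 : (0 <= dist_to_set vb D)%E.
  by apply: le_ereal_inf_tmp => _ [v _ <-]; rewrite lee_fin enorm_ge0.
apply/eqP; rewrite eq_le; apply/andP; split; last first.
  apply: le_ereal_inf_tmp => _ [k [k0 incl] <-].
  rewrite inve_ple ?inE ?lee_fin //.
  apply: le_ereal_inf_tmp => _ [v Dv <-].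
  have kv := inclusion_dist_ge k0 incl Dv.
  rewrite inve_ple ?inE ?lee_fin ?enorm_ge0 // inver.
  have [v0|v0] := eqVneq (enorm (v - vb)) 0.
    by move: kv; rewrite v0 mulr0 ler10.
  by rewrite lee_fin -[X in X <= _]mul1r ler_pdivrMr // lt_def v0 enorm_ge0.
have : (0 <= (dist_to_set vb D)^-1)%E by rewrite inve_ge0.
case E : (dist_to_set vb D)^-1%E => [r| |] // r0; last by rewrite leey.
rewrite lee_fin in r0; apply/lee_addgt0Pr => e e0.
apply: ereal_inf_lbound; exists (r + e) => //; split.
  by rewrite addr_ge0 // ltW.
(* [r + e / 2] lies strictly between the inverse distance and [r + e] *)
have l0 : 0 < r + e / 2 by rewrite ltr_wpDl // divr_gt0.
apply: (inclusion_of_lt_dist l0); first lra.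
move=> v Dv; rewrite -lte_fin.
apply: (@lt_le_trans _ _ (dist_to_set vb D)); last first.
  by apply: ereal_inf_lbound; exists v.
have := inver (r + e / 2); rewrite gt_eqF // => <-.
rewrite inve_plt ?inE ?lee_fin ?(ltW l0) // E lte_fin; lra.
Qed.

(** Lower semicontinuity is available below the level [c + e] only, which
suffices because the graph is cut at levels [a <= c + e / 2]. *)
Lemma level_set_locally_closed : locally_closed_at (gph S) (c, xb).
Proof.
have [e e0 glsc] := @lsc_near_tilt _ _ f vb xb fxb_fin f_lsc.
pose N := [set p : R * 'rV[R]_n |
  `|p.1 - c| <= e / 2 /\ enorm (p.2 - xb) <= e / 2].
have e2 : 0 < e / 2 by rewrite divr_gt0.
have nearp (a : R) (x : 'rV[R]_n) (P : set R) (Q : set 'rV[R]_n) :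
    nbhs a P -> nbhs x Q -> nbhs (a, x) (P `*` Q).
  by move=> aP xQ; exists (P, Q).
have Ncl : closed N.
  move=> [a x] clN; split=> /=; apply/ler_addgt0Pr => r r0;
    have := clN _ (nearp a x _ _ (nbhsx_ballx a r r0) (near_enorm_lt x r0)).
    move=> [[b y] [[/= bc _] [/= + _]]]; rewrite /ball /= => ab.
    have := ler_distD b a c; lra.
  move=> [[b y] [[/= _ yx] [_ /= xy]]].
  by have := enorm_triangle y x xb; rewrite (enormC x y); lra.
exists N; split => //.
  apply: filterS (nearp c xb _ _ (nbhsx_ballx c _ e2) (near_enorm_lt xb e2)).
  by move=> [a x] [/=]; rewrite /ball /= distrC => /ltW ? /ltW ?.
move=> [a x] clSN; have [/= ac xxb] : N (a, x).
  by apply: Ncl => B /clSN [p [[_ Np] Bp]]; exists p.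
split; last by split.
rewrite /gph /S /level_set /= leNgt; apply/negP => ax.
have ace : a < c + e by move: ac; rewrite ler_distlC; lra.
have [s as_] : exists2 s : R, a < s &
    (s%:E < mine (tilt f vb xb x) (c + e)%:E)%E.
  by apply: ereal_between; rewrite lt_min ax lte_fin.
rewrite lt_min lte_fin => /andP[sg sc].
have xn : \forall y \near x, (s%:E < tilt f vb xb y)%E.
  by apply: glsc sg; [lra|rewrite tilt_center fxb -EFinD lte_fin].
have an : \forall b \near a, b < s by exact: lt_nbhsl.
have [[b y] [[Sy _] [/= bs sy]]] := clSN _ (nearp a x _ _ an xn).
have := lt_le_trans sy Sy; rewrite lte_fin => /lt_trans/(_ bs).
by rewrite ltxx.
Qed.

End Modulus.

(* The inverse on [\bar R] satisfies [0^-1 = +oo] and [+oo^-1 = 0]. *)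
Theorem theorem4p1 (R : realType) (n : nat) (f : 'rV[R]_n -> \bar R)
    (xb vb : 'rV[R]_n) (f_fin : f xb \is a fin_num)
    (f_lsc : locally_lsc_at f xb) :
  let S := level_set f vb xb in
  let X := [set a : R | (f xb <= a%:E)%E] in
  (lipschitz_like S X (fine (f xb)) xb <->
     ~ outer_limiting_subdiff f vb xb vb) /\
  graphical_modulus S X (fine (f xb)) xb =
    ((dist_to_set vb (outer_limiting_subdiff f vb xb))^-1)%E.
Proof.
move=> S X; have fxb : f xb = (fine (f xb))%:E by rewrite fineK.
have XE : X = [set a : R | ((fine (f xb))%:E <= a%:E)%E] by rewrite /X -fxb.
rewrite XE; split; last exact: modulus_eq.
split.
  move=> [_ _ _ [k k0 incl]] /(inclusion_dist_ge fxb k0 incl).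
  by rewrite subrr enorm0 mulr0 ler10.
move=> NDvb; split.
- by rewrite /= -fxb.
- by rewrite /S /level_set /= subrr dotv0r sube0 -fxb.
- exact: level_set_locally_closed.
- exact: notin_outer_inclusion NDvb.
Qed.
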